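(* Let $w$ be a weight function on $[0,1]$ and let $\phi w(x):=(1-x)^2w(x)$. Define $$P_n(x,y)=p_n(w;x)+p_n(w;y)-p_n(w;1),\quad n=0,1,2,\dots,$$ $$Q_n(x,y)=(1-x)\,p_{n-1}(\phi w;x)-(1-y)\,p_{n-1}(\phi w;y),\quad n=1,2,\dots.$$ Then $P_n$ and $Q_n$ are two polynomials in $\mathcal H_n^2(w)$ and they are mutually orthogonal with respect to $\langle\cdot,\cdot\rangle_w$. Furthermore, $$\langle P_n,P_n\rangle_w=2h_n(w)\quad\text{and}\quad\langle Q_n,Q_n\rangle_w=2h_{n-1}(\phi w).$$
   Context: A weight function on $[0,1]$ is a nonnegative measurable function with all moments finite and with positive integral. For a weight $v$ on $[0,1]$, $p_n(v;\cdot)$ denotes an orthogonal polynomial of degree exactly $n$ with respect to $v$ (i.e. orthogonal in $L^2(v\,dx,[0,1])$ to all polynomials of lower degree), and $h_n(v)=\int_0^1|p_n(v;x)|^2v(x)\,dx$. Define $$\langle f,g\rangle_w=\int_0^1 f(x,1)g(x,1)w(x)\,dx+\int_0^1 f(1,y)g(1,y)w(y)\,dy,$$ an inner product on $\mathbb R[x,y]/I$ with $I=\langle(1-x)(1-y)\rangle$. $\mathcal H_n^2(w)$ is the space of classes modulo $I$ of polynomials of total degree at most $n$ that are orthogonal, with respect to $\langle\cdot,\cdot\rangle_w$, to all polynomials of total degree at most $n-1$. *)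

(* Defs.v *)
From HB Require Import structures.
From mathcomp Require Import all_boot all_order all_algebra.
From mathcomp Require Import ring_quotient.
From mathcomp Require mpoly.
From mathcomp Require Import ring.
From mathcomp Require Import all_classical all_reals all_analysis.
From mathcomp Require Import measurable_realfun.
(* The notations of mpoly clash with those of mathcomp-analysis. *)
Export -(notations) mpoly.
Export numFieldNormedType.Exports.
Export Order.TTheory GRing.Theory Num.Theory.

Set Implicit Arguments.
Unset Strict Implicit.
Unset Printing Implicit Defensive.

Local Open Scope classical_set_scope.
Local Open Scope ring_scope.

Definition int01 {R : realType} (f : R -> R) : R :=
  \int[@lebesgue_measure R]_(x in `[0, 1]) f x.

(* As [w] is measurable, integrability of [x ^+ n * w x] says that the n-th
   moment is finite. *)
Record is_weight {R : realType} (w : R -> R) : Prop := IsWeight {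
  weight_measurable : measurable_fun `[0 : R, 1] w;
  weight_ge0 : forall x : R, 0 <= x <= 1 -> 0 <= w x;
  weight_moments : forall n : nat,
    (@lebesgue_measure R).-integrable `[0, 1] (fun x => (x ^+ n * w x)%:E);
  weight_int_gt0 : 0 < int01 w }.

Definition phi_weight {R : realType} (w : R -> R) (x : R) : R :=
  (1 - x) ^+ 2 * w x.

(* [size p = n.+1] means that p has degree exactly n, and [(size q <= n)%N]
   that q has degree less than n. *)
Definition is_orthopoly {R : realType} (v : R -> R) (n : nat) (p : {poly R}) :=
  size p = n.+1 /\
  forall q : {poly R}, (size q <= n)%N ->
    int01 (fun x => p.[x] * q.[x] * v x) = 0.

Definition sqnorm {R : realType} (v : R -> R) (p : {poly R}) : R :=
  int01 (fun x => `|p.[x]| ^+ 2 * v x).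

Notation Rxy R := (mpoly 2 R).

Definition vx {R : realType} : Rxy R := mpolyX R (mnm1 (ord0 : 'I_2)).
Definition vy {R : realType} : Rxy R := mpolyX R (mnm1 (ord_max : 'I_2)).

Definition eval2 {R : realType} (f : Rxy R) (x y : R) : R :=
  meval (fun i : 'I_2 => if i == ord0 then x else y) f.

(* [subst1 p z] is the univariate p with its variable replaced by z. *)
Definition subst1 {R : realType} (p : {poly R}) (z : Rxy R) : Rxy R :=
  (map_poly (@mpolyC 2 R) p).[z].

(* [tdeg_lt f n]: f has total degree less than n; only f = 0 when n = 0. *)
Definition tdeg_lt {R : realType} (f : Rxy R) (n : nat) : bool :=
  (@mmeasure 2 R mdeg f <= n)%N.

Definition idealI (R : realType) : {pred Rxy R} :=
  fun f => `[< exists g, f = g * ((1 - vx) * (1 - vy)) >].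
Arguments idealI : clear implicits.

Lemma idealIP (R : realType) (f : Rxy R) :
  reflect (exists g, f = g * ((1 - vx) * (1 - vy))) (f \in idealI R).
Proof. exact: asboolP. Qed.

Lemma eval2_vx (R : realType) (x y : R) : eval2 vx x y = x.
Proof. by rewrite /eval2 /vx mevalXU eqxx. Qed.

Lemma eval2_vy (R : realType) (x y : R) : eval2 vy x y = y.
Proof. by rewrite /eval2 /vy mevalXU. Qed.

Lemma eval2_idealI (R : realType) (f : Rxy R) (x y : R) :
  f \in idealI R -> (1 - x) * (1 - y) = 0 -> eval2 f x y = 0.
Proof.
move=> /idealIP[g ->] xy0; rewrite /eval2 !rmorphM !rmorphB !rmorph1 /=.
by rewrite -!/(eval2 _ x y) eval2_vx eval2_vy xy0 mulr0.
Qed.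

Lemma idealI_closed (R : realType) : idealr_closed (idealI R).
Proof.
split.
- by apply/idealIP; exists 0; rewrite mul0r.
- apply/negP => I1.
  have h : (1 - 1) * (1 - 1) = 0 :> R by rewrite subrr mul0r.
  have := eval2_idealI I1 h.
  by rewrite /eval2 rmorph1; apply/eqP; rewrite oner_eq0.
- move=> a u v /idealIP[g ->] /idealIP[h ->]; apply/idealIP.
  by exists (a * g + h); rewrite [RHS]mulrDl (mulrA a).
Qed.

HB.instance Definition _ (R : realType) :=
  isIdealr.Build (Rxy R) (idealI R) (@idealI_closed R).

Definition RxyI (R : realType) := @Quotient.quot (Rxy R) (idealI R).

Definition cls {R : realType} (f : Rxy R) : RxyI R := (\pi_(RxyI R) f)%qT.

Definition ip_poly {R : realType} (w : R -> R) (f g : Rxy R) : R :=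
  int01 (fun x => eval2 f x 1 * eval2 g x 1 * w x) +
  int01 (fun y => eval2 f 1 y * eval2 g 1 y * w y).

Definition ip {R : realType} (w : R -> R) (c d : RxyI R) : R :=
  ip_poly w (repr c) (repr d).

Lemma eval2_repr (R : realType) (f : Rxy R) (x y : R) :
  (1 - x) * (1 - y) = 0 -> eval2 (repr (cls f)) x y = eval2 f x y.
Proof.
move=> xy0; apply/eqP; rewrite -subr_eq0 /eval2 -rmorphB /= -/(eval2 _ x y).
apply/eqP/eval2_idealI => //; rewrite Quotient.idealrBE; apply/eqP.
exact: reprK.
Qed.

Lemma ip_cls (R : realType) (w : R -> R) (f g : Rxy R) :
  ip w (cls f) (cls g) = ip_poly w f g.
Proof.
have h1 (x : R) : (1 - x) * (1 - 1) = 0 by rewrite subrr mulr0.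
have h2 (x : R) : (1 - 1) * (1 - x) = 0 by rewrite subrr mul0r.
by rewrite /ip /ip_poly; congr (int01 _ + int01 _); apply/funext => x;
   rewrite !eval2_repr.
Qed.

(* A class has degree at most n when some representative does. *)
Definition Hspace {R : realType} (w : R -> R) (n : nat) : set (RxyI R) :=
  [set c | (exists2 f, tdeg_lt f n.+1 & c = cls f) /\
           forall g, tdeg_lt g n -> ip w c (cls g) = 0].

Definition Ppoly {R : realType} (p : {poly R}) : Rxy R :=
  subst1 p vx + subst1 p vy - mpolyC 2 p.[1].

Definition Qpoly {R : realType} (q : {poly R}) : Rxy R :=
  (1 - vx) * subst1 q vx - (1 - vy) * subst1 q vy.

Section PhiWeight.
Variables (R : realType) (w : R -> R).
Hypothesis ww : is_weight w.
Local Notation mu := (@lebesgue_measure R).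

Lemma phi_weight_measurable : measurable_fun `[0 : R, 1] (phi_weight w).
Proof.
apply: measurable_funM; last exact: weight_measurable ww.
by apply: measurable_funX; apply: measurable_funB.
Qed.

Lemma phi_weight_ge0 x : 0 <= x <= 1 -> 0 <= phi_weight w x.
Proof. by move=> x01; rewrite mulr_ge0 ?sqr_ge0 ?(weight_ge0 ww). Qed.

Lemma phi_weight_moments (n : nat) :
  mu.-integrable `[0, 1] (fun x => (x ^+ n * phi_weight w x)%:E).
Proof.
have -> : (fun x => (x ^+ n * phi_weight w x)%:E) =
    ((fun x => (x ^+ n * w x)%:E) \- (fun x => (2 : R)%:E * (x ^+ n.+1 * w x)%:E)
      \+ (fun x => (x ^+ n.+2 * w x)%:E))%E.
  apply/funext => x; rewrite /phi_weight.
  transitivity (x ^+ n * w x - 2 * (x ^+ n.+1 * w x) + x ^+ n.+2 * w x)%:E.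
    by congr EFin; rewrite !exprS; ring.
  by rewrite EFinD EFinB EFinM.
apply: integrableD => //; last exact: weight_moments ww _.
apply: integrableB => //; first exact: weight_moments ww _.
by apply: integrableZl => //; exact: weight_moments ww _.
Qed.

Lemma phi_weight_int_gt0 : 0 < int01 (phi_weight w).
Proof.
have mI : measurable (`[0, 1]%classic : set R) by [].
have mw := weight_measurable ww.
have mphi := phi_weight_measurable.
rewrite lt_neqAle; apply/andP; split; last first.
  by apply: Rintegral_ge0 => x /=; rewrite in_itv /=; exact: phi_weight_ge0.
apply/eqP => /esym phi0; have := weight_int_gt0 ww.
suff -> : int01 w = 0 by rewrite ltxx.
have iphi : mu.-integrable `[0, 1] (EFin \o phi_weight w).
  apply: eq_integrable (phi_weight_moments 0) => // x _ /=.
  by rewrite expr0 mul1r.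
have abs0 : (\int[mu]_(x in `[0%R, 1%R]) `|(EFin \o phi_weight w) x| = 0)%E.
  transitivity (\int[mu]_(x in `[0%R, 1%R]) (phi_weight w x)%:E)%E.
    apply: eq_integral => x; rewrite inE /= in_itv /= => x01.
    by rewrite ger0_norm // phi_weight_ge0.
  move: phi0; rewrite /int01 /Rintegral => phi0.
  by rewrite -[LHS]fineK ?phi0 //; exact: integrable_fin_num.
have mEphi : measurable_fun `[0 : R, 1] (EFin \o phi_weight w).
  exact/measurable_EFinP.
have ae0 := (ae_eq_integral_abs lebesgue_measure mI mEphi).1 abs0.
have mEw : measurable_fun (`[0 : R, 1]%classic `\ 1) (EFin \o w).
  by apply/measurable_EFinP; apply: measurable_funS mw => // x [].
have mI1 : measurable (`[0 : R, 1]%classic `\ 1) by exact: measurableD.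
rewrite /int01 /Rintegral -(integral_setD1 mI1 mEw).
rewrite (@ae_eq_integral _ _ _ lebesgue_measure _ (cst 0%E)) ?integral0 //.
apply: filterS ae0 => x /= h [x01 x1].
have /eqP := h x01.
rewrite eqe mulf_eq0 expf_eq0 /= subr_eq0 => /orP[/eqP e | /eqP -> //].
by case: x1.
Qed.

Lemma phi_is_weight : is_weight (phi_weight w).
Proof.
split; [exact: phi_weight_measurable | exact: phi_weight_ge0 |
        exact: phi_weight_moments | exact: phi_weight_int_gt0].
Qed.

End PhiWeight.

(* Main.v *)
Require Import Defs.
From mathcomp Require Import all_boot all_order all_algebra.
From mathcomp Require Import all_classical all_reals all_analysis.
From mathcomp Require Import ring.

Set Implicit Arguments.
Unset Strict Implicit.

Local Open Scope classical_set_scope.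
Local Open Scope ring_scope.

(** On the two edges y = 1 and x = 1 a bivariate polynomial g restricts to two
    univariate polynomials c(x) = g(x, 1) and d(y) = g(1, y), of degree at most
    the total degree of g, with c(1) = d(1) at the common corner. As both
    edges carry the same weight w, the inner product of two polynomials with
    edge restrictions (a, b) and (c, d) is the single integral of
    (a c + b d) w (lemma [ip_edges]).

    The restrictions of P_n are (p, p), with p = p_n(w), and those of Q_n are
    (s, -s), with s = (1 - X) p_{n-1}(phi w). Everything follows:
    - <P_n, g> is the integral of p (c + d) w, zero by orthogonality of p;
    - <Q_n, g> is the integral of s (c - d) w; as c - d vanishes at 1 it is
      (1 - X) r with r of degree at most n - 2, and the integrand is
      p_{n-1}(phi w) r (1 - x)^2 w, so that orthogonality with respect to phi w
      applies;
    - <P_n, Q_n> is the integral of (p s - p s) w;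
    - <P_n, P_n> and <Q_n, Q_n> are twice the integrals of p^2 w and of
      s^2 w = p_{n-1}(phi w)^2 phi w. *)

(** * Integration of polynomials against a weight *)

Definition wint {R : realType} (w : R -> R) (a : {poly R}) : R :=
  int01 (fun x => a.[x] * w x).

(** A polynomial is a finite combination of monomials, whose integrability
    against [w] is the finiteness of the moments. This is what makes [wint]
    additive in [wintD]. *)
Lemma integrable_poly_weight (R : realType) (w : R -> R) (a : {poly R}) :
  is_weight w ->
  (@lebesgue_measure R).-integrable `[0, 1] (EFin \o (fun x => a.[x] * w x)).
Proof.
move=> hw; have -> : EFin \o (fun x => a.[x] * w x) = (fun x =>
    \sum_(i < size a) (a`_i)%:E * (x ^+ i * w x)%:E)%E.
  apply/funext => x /=; rewrite horner_coef mulr_suml -sumEFin.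
  by apply: eq_bigr => i _; rewrite -EFinM mulrA.
apply: integrable_sum => // i _; apply: integrableZl => //.
exact: weight_moments hw _.
Qed.

Lemma wintD (R : realType) (w : R -> R) (a b : {poly R}) :
  is_weight w -> wint w (a + b) = wint w a + wint w b.
Proof.
move=> hw; rewrite /wint /int01 -RintegralD //.
- by congr (Rintegral _ _ _); apply/funext => x; rewrite hornerD mulrDl.
- exact: integrable_poly_weight.
- exact: integrable_poly_weight.
Qed.

Lemma wint0 (R : realType) (w : R -> R) : wint w 0 = 0.
Proof.
rewrite /wint /int01 /Rintegral.
under eq_integral do rewrite horner0 mul0r.
by rewrite integral0.
Qed.

(** The factor (1 - x)^2 that separates the weight [phi_weight w] from [w] can
    be moved into the polynomial: this links the two orthogonality relations. *)
Lemma wint_phi_weight (R : realType) (w : R -> R) (a : {poly R}) :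
  wint (phi_weight w) a = wint w ((1 - 'X) ^+ 2 * a).
Proof.
rewrite /wint; congr int01; apply/funext => x.
by rewrite /phi_weight hornerM horner_exp hornerD hornerN hornerX hornerC; ring.
Qed.

Lemma wint_orthopoly (R : realType) (w : R -> R) (n : nat) (p a : {poly R}) :
  is_orthopoly w n p -> (size a <= n)%N -> wint w (p * a) = 0.
Proof.
move=> [_ hp] /hp <-; rewrite /wint; congr int01.
by apply/funext => x; rewrite hornerM.
Qed.

Lemma sqnormE (R : realType) (w : R -> R) (p : {poly R}) :
  sqnorm w p = wint w (p * p).
Proof.
rewrite /sqnorm /wint; congr int01; apply/funext => x.
by rewrite real_normK ?num_real // hornerM expr2.
Qed.

(** * Restriction of bivariate polynomials to the two edges *)

Definition edges {R : realType} (f : Rxy R) (a b : {poly R}) : Prop :=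
  forall x : R, eval2 f x 1 = a.[x] /\ eval2 f 1 x = b.[x].

(** Both edges carry the same weight, so the two integrals of the inner product
    merge into one, and the symmetry of P_n and the antisymmetry of Q_n become
    plain polynomial identities. *)
Lemma ip_edges (R : realType) (w : R -> R) (f g : Rxy R)
    (a b c d : {poly R}) :
  is_weight w -> edges f a b -> edges g c d ->
  ip w (cls f) (cls g) = wint w (a * c + b * d).
Proof.
move=> hw hf hg; rewrite ip_cls wintD // /ip_poly /wint.
by congr (int01 _ + int01 _); apply/funext => x; rewrite hornerM;
   case: (hf x) => f1 f2; case: (hg x) => g1 g2; rewrite ?f1 ?g1 ?f2 ?g2.
Qed.

(** Substituting polynomials of degree at most 1 for the variables does not
    increase the degree: each monomial [m] yields degree at most [mdeg m]. *)
Lemma size_mmap_polyC (R : realType) (h : 'I_2 -> {poly R}) (g : Rxy R) :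
  (forall i, size (h i) <= 2)%N ->
  (size (mmap polyC h g) <= mmeasure mdeg g)%N.
Proof.
move=> hh; rewrite /mmap; apply: leq_trans (size_sum _ _ _) _.
rewrite big_seq; apply/bigmax_leqP_seq => m mg _.
rewrite mul_polyC; apply: leq_trans (size_scale_leq _ _) _.
have := mmeasure_mnm_lt mdeg mg; rewrite /= mdegE; apply: leq_trans.
rewrite /mmap1.
elim/big_ind2: _ => [|a k b l ha hb|i _]; first by rewrite size_poly1.
  apply: leq_trans (size_polyMleq _ _) _.
  by rewrite -subn1 leq_subLR add1n -addSn -addnS leq_add.
apply: leq_trans (size_poly_exp_leq _ _) _.
by rewrite ltnS -[leqRHS]mul1n leq_mul2r -subn1 leq_subLR hh orbT.
Qed.

Lemma meval_poly (R : realType) (h : 'I_2 -> {poly R}) (g : Rxy R) (x : R) :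
  (mmap polyC h g).[x] = meval (fun i => (h i).[x]) g.
Proof.
rewrite mevalE /mmap horner_sum; apply: eq_bigr => m _.
rewrite hornerM hornerC /mmap1 horner_prod; congr (_ * _).
by apply: eq_bigr => i _; rewrite horner_exp.
Qed.

(** The restrictions are the formal substitutions y := 1 and x := 1; they agree
    at 1 because the edges meet at the corner (1, 1). *)
Lemma edges_exist (R : realType) (g : Rxy R) (n : nat) : tdeg_lt g n ->
  exists c d, [/\ edges g c d, (size c <= n)%N, (size d <= n)%N
                 & c.[1] = d.[1]].
Proof.
move=> gn.
pose hc (i : 'I_2) : {poly R} := if i == ord0 then 'X else 1.
pose hd (i : 'I_2) : {poly R} := if i == ord0 then 1 else 'X.
have hc2 i : (size (hc i) <= 2)%N.
  by rewrite /hc; case: ifP; rewrite ?size_polyX ?size_poly1.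
have hd2 i : (size (hd i) <= 2)%N.
  by rewrite /hd; case: ifP; rewrite ?size_polyX ?size_poly1.
exists (mmap polyC hc g), (mmap polyC hd g); split.
- move=> x; rewrite !meval_poly.
  by split; apply: meval_eq => i; rewrite /hc /hd;
     case: ifP; rewrite ?hornerX ?hornerC.
- exact: leq_trans (size_mmap_polyC _ hc2) gn.
- exact: leq_trans (size_mmap_polyC _ hd2) gn.
- rewrite !meval_poly; apply: meval_eq => i.
  by rewrite /hc /hd; case: ifP; rewrite ?hornerX ?hornerC.
Qed.

Lemma eval2_subst1 (R : realType) (p : {poly R}) (z : Rxy R) (x y : R) :
  eval2 (subst1 p z) x y = p.[eval2 z x y].
Proof.
rewrite /eval2 /subst1 (horner_coef_wide _ (size_poly _ _)).
rewrite horner_coef raddf_sum; apply: eq_bigr => i _ /=.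
by rewrite coef_map mevalM mevalC rmorphXn.
Qed.

Lemma tdeg_lt_subst1 (R : realType) (p : {poly R}) (i : 'I_2) :
  tdeg_lt (subst1 p (mpolyX R (mnm1 i))) (size p).
Proof.
rewrite /tdeg_lt /subst1 (horner_coef_wide _ (size_poly _ _)).
apply: leq_trans (mmeasure_sum _ _ _ _) _; apply/bigmax_leqP => k _.
rewrite coef_map /= mul_mpolyC mpolyXn.
apply: leq_trans (mmeasureZ_le _ _ _) _.
by rewrite mmeasureX /= mdegMn mdeg1 mul1n.
Qed.

Lemma tdeg_ltD (R : realType) (f g : Rxy R) (n : nat) :
  tdeg_lt f n -> tdeg_lt g n -> tdeg_lt (f + g) n.
Proof.
rewrite /tdeg_lt => hf hg.
by apply: leq_trans (mmeasureD_le _ _ _) _; rewrite geq_max hf.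
Qed.

Lemma tdeg_ltN (R : realType) (f : Rxy R) (n : nat) :
  tdeg_lt f n -> tdeg_lt (- f) n.
Proof. by rewrite /tdeg_lt mmeasureN. Qed.

(** * The polynomials P_n and Q_n *)

Lemma edges_Ppoly (R : realType) (p : {poly R}) : edges (Ppoly p) p p.
Proof.
move=> x; rewrite /Ppoly /eval2 !mevalB !mevalD !mevalC -!/(eval2 _ _ _).
by rewrite !eval2_subst1 !eval2_vx !eval2_vy; split; ring.
Qed.

(** Substitution is a ring morphism, so the factors 1 - x and 1 - y can be
    absorbed; evaluation and degree of Q_n then follow from those of [subst1]. *)
Lemma QpolyE (R : realType) (q : {poly R}) :
  Qpoly q = subst1 ((1 - 'X) * q) vx - subst1 ((1 - 'X) * q) vy.
Proof.
by rewrite /Qpoly /subst1 rmorphM rmorphB rmorph1 /= map_polyX !hornerM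
           !hornerD !hornerN !hornerX !hornerC.
Qed.

(** On each edge one of the two terms is evaluated at 1, where (1 - X) q
    vanishes. *)
Lemma edges_Qpoly (R : realType) (q : {poly R}) :
  edges (Qpoly q) ((1 - 'X) * q) (- ((1 - 'X) * q)).
Proof.
move=> x; rewrite QpolyE /eval2 !mevalB -!/(eval2 _ _ _).
rewrite !eval2_subst1 !eval2_vx !eval2_vy hornerN.
have -> : ((1 - 'X) * q).[1] = 0.
  by rewrite hornerM hornerD hornerN hornerX hornerC subrr mul0r.
by rewrite subr0 sub0r.
Qed.

Lemma tdeg_lt_Ppoly (R : realType) (p : {poly R}) (n : nat) :
  size p = n.+1 -> tdeg_lt (Ppoly p) n.+1.
Proof.
move=> pn; apply: tdeg_ltD.
  by apply: tdeg_ltD; rewrite -pn; exact: tdeg_lt_subst1.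
by apply: tdeg_ltN; rewrite /tdeg_lt mmeasureC; case: (_ != 0).
Qed.

Lemma size_mul_1subX (R : realType) (r : {poly R}) :
  r != 0 -> size ((1 - 'X) * r) = (size r).+1.
Proof.
move=> r0; rewrite -opprB mulNr size_polyN mulrC.
by rewrite size_Mmonic ?monicXsubC // -polyC1 size_XsubC addn2.
Qed.

Lemma tdeg_lt_Qpoly (R : realType) (q : {poly R}) (n : nat) :
  size q = n.+1 -> tdeg_lt (Qpoly q) n.+2.
Proof.
move=> qn.
have sn : size ((1 - 'X) * q) = n.+2.
  by rewrite size_mul_1subX ?qn // -size_poly_eq0 qn.
rewrite QpolyE -sn.
by apply: tdeg_ltD; [|apply: tdeg_ltN]; exact: tdeg_lt_subst1.
Qed.

Lemma factor_1subX (R : realType) (e : {poly R}) (n : nat) :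
  (size e <= n.+1)%N -> e.[1] = 0 ->
  exists2 r, e = (1 - 'X) * r & (size r <= n)%N.
Proof.
move=> en /eqP /factor_theorem[r er].
have {}er : e = (1 - 'X) * - r by rewrite er polyC1; ring.
exists (- r) => //; have [->|r0] := eqVneq (- r) 0; first by rewrite size_poly0.
by move: en; rewrite er size_mul_1subX.
Qed.

(** Against a test polynomial with restrictions [c] and [d], the integrand is
    p (c + d) w. *)
Lemma Hspace_Ppoly (R : realType) (w : R -> R) (n : nat) (p : {poly R}) :
  is_weight w -> is_orthopoly w n p -> Hspace w n (cls (Ppoly p)).
Proof.
move=> hw hp; split.
  by exists (Ppoly p) => //; apply: tdeg_lt_Ppoly; case: hp.
move=> g /edges_exist[c [d [gcd cn dn _]]].
rewrite (ip_edges hw (edges_Ppoly p) gcd) -mulrDr (wint_orthopoly hp) //.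
by apply: leq_trans (size_polyD _ _) _; rewrite geq_max cn.
Qed.

(** Against a test polynomial with restrictions [c] and [d], the integrand is
    (1 - x) q (c - d) w. The common corner value gives c - d a factor 1 - x, so
    one degree is lost and the second factor 1 - x completes the weight
    [phi_weight w]. This is why [q] has degree one less than the class. *)
Lemma Hspace_Qpoly (R : realType) (w : R -> R) (n : nat) (q : {poly R}) :
  is_weight w -> is_orthopoly (phi_weight w) n q ->
  Hspace w n.+1 (cls (Qpoly q)).
Proof.
move=> hw hq; split.
  by exists (Qpoly q) => //; apply: tdeg_lt_Qpoly; case: hq.
move=> g /edges_exist[c [d [gcd cn dn cd1]]].
rewrite (ip_edges hw (edges_Qpoly q) gcd).
have [||r cdr rn] := @factor_1subX R (c - d) n.
- by apply: leq_trans (size_polyD _ _) _; rewrite size_polyN geq_max cn.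
- by rewrite hornerD hornerN cd1 subrr.
have -> : (1 - 'X) * q * c + - ((1 - 'X) * q) * d
    = (1 - 'X) ^+ 2 * (q * r).
  by rewrite mulNr -mulrBr cdr; ring.
by rewrite -wint_phi_weight (wint_orthopoly hq).
Qed.

Unset Implicit Arguments.
Set Strict Implicit.

Theorem theorem2p2 (R : realType) (w : R -> R) (p q : nat -> {poly R})
    (hw : is_weight w)
    (hp : forall n : nat, is_orthopoly w n (p n))
    (hq : forall n : nat, is_orthopoly (phi_weight w) n (q n)) :
  let P (n : nat) : RxyI R := cls (Ppoly (p n)) in
  let Q (n : nat) : RxyI R := cls (Qpoly (q n.-1)) in
  (forall n : nat, Hspace w n (P n)) /\
  (forall n : nat, (0 < n)%N -> Hspace w n (Q n)) /\
  (forall n : nat, (0 < n)%N -> ip w (P n) (Q n) = 0) /\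
  (forall n : nat, ip w (P n) (P n) = 2 * sqnorm w (p n)) /\
  (forall n : nat, (0 < n)%N ->
     ip w (Q n) (Q n) = 2 * sqnorm (phi_weight w) (q n.-1)).
Proof.
move=> P Q; split; last split; last split; last split.
- by move=> n; exact: Hspace_Ppoly.
- by case=> // n _; exact: Hspace_Qpoly.
- move=> n _; rewrite (ip_edges hw (edges_Ppoly _) (edges_Qpoly _)).
  by rewrite mulrN subrr wint0.
- move=> n; rewrite (ip_edges hw (edges_Ppoly _) (edges_Ppoly _)).
  by rewrite wintD // sqnormE mulr_natl mulr2n.
- move=> n _; rewrite (ip_edges hw (edges_Qpoly _) (edges_Qpoly _)).
  by rewrite mulrNN wintD // sqnormE wint_phi_weight mulr_natl mulr2n mulrACA.
Qed.
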